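(* Let $z_1,z_2,z_3\in\mathbb T=\{z\in\mathbb C:|z|=1\}$ be the vertices of a triangle circumscribed about a central conic with foci $a_1,a_2\in\mathbb C$. Then there exists $\lambda\in\mathbb T$ such that $$z_1+z_2+z_3=a_1+a_2+\overline{a_1}\,\overline{a_2}\,\lambda,$$ $$z_1z_2+z_2z_3+z_3z_1=a_1a_2+(\overline{a_1}+\overline{a_2})\lambda,$$ $$z_1z_2z_3=\lambda.$$
   Context: The plane is identified with $\mathbb C$. A central conic is an ellipse or a hyperbola. A triangle is circumscribed about a conic if each of its three side lines is tangent to the conic (the point of tangency need not lie on the side segment). *)

(* Defs.v *)
From Stdlib Require Import Reals.
From Coquelicot Require Import Coquelicot.

Open Scope C_scope.

Definition on_unit_circle (z : C) : Prop := Cmod z = 1%R.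

(** For [a1 = a2] this is the circle of radius [r / 2] centred at [a1]. *)
Definition is_ellipse_with_foci (a1 a2 : C) (S : C -> Prop) : Prop :=
  exists r : R, (Cmod (a1 - a2) < r)%R /\
    forall z : C, S z <-> (Cmod (z - a1) + Cmod (z - a2))%R = r.

(** The absolute value makes [S] consist of both branches. *)
Definition is_hyperbola_with_foci (a1 a2 : C) (S : C -> Prop) : Prop :=
  exists r : R, (0 < r < Cmod (a1 - a2))%R /\
    forall z : C, S z <-> Rabs (Cmod (z - a1) - Cmod (z - a2)) = r.

Definition is_central_conic_with_foci (a1 a2 : C) (S : C -> Prop) : Prop :=
  is_ellipse_with_foci a1 a2 S \/ is_hyperbola_with_foci a1 a2 S.

(** The line through [z] and [w], for [z <> w]. *)
Definition line_through (z w : C) : C -> Prop :=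
  fun x => exists t : R, x = z + t * (w - z).

Definition is_triangle (z1 z2 z3 : C) : Prop :=
  z1 <> z2 /\ ~ line_through z1 z2 z3.

(** [v] is the velocity at [p] of a curve lying in [S]; the curve is
    differentiated as a function of a real variable, [C] being a normed space
    over [R]. *)
Definition tangent_vector (S : C -> Prop) (p v : C) : Prop :=
  exists gamma : R -> C,
    gamma 0%R = p /\
    locally 0%R (fun t => S (gamma t)) /\
    is_derive (K := R_AbsRing) (V := C_R_NormedModule) gamma 0%R v.

(** Tangency is required at a point [p] of the affine plane, so an asymptote is
    not tangent to its hyperbola. Meeting the curve exactly once would not be
    enough: a line parallel to an asymptote does. *)
Definition is_tangent_line (L S : C -> Prop) : Prop :=
  exists p v : C, S p /\ v <> 0 /\ tangent_vector S p v /\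
    forall x : C, L x <-> exists t : R, x = p + t * v.

Definition circumscribed_about (z1 z2 z3 : C) (S : C -> Prop) : Prop :=
  is_tangent_line (line_through z1 z2) S /\
  is_tangent_line (line_through z2 z3) S /\
  is_tangent_line (line_through z3 z1) S.

(* Main.v *)
(** The product of the signed distances from the two foci to a tangent line is
    the same for all tangents of a central conic. For the chord through two
    points [z], [w] of the unit circle this reads [P1 * P2 = k * z * w] with
    [Pi = ai + z * w * Cconj ai - (z + w)], where [k] depends on the conic only.
    The three sides therefore give one monic quartic having [z1], [z2], [z3] as
    roots; its cubic and constant coefficients yield the formula for
    [z1 + z2 + z3] with [lambda = z1 * z2 * z3], and conjugating that formula
    yields the one for [z1 * z2 + z2 * z3 + z3 * z1]. *)

Require Import Defs.
From Stdlib Require Import Reals Lra.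
From Coquelicot Require Import Coquelicot.

Open Scope C_scope.

Definition dot (u w : C) : R := (Re u * Re w + Im u * Im w)%R.
(** [cross v (p - a)] is [Cmod v] times the signed distance of [a] from the line through [p] with
    direction [v]. *)
Definition cross (u w : C) : R := (Re u * Im w - Im u * Re w)%R.

Lemma dot_cross_square (u w : C) :
  (dot u w ^ 2 + cross u w ^ 2)%R = (Cmod w ^ 2 * Cmod u ^ 2)%R.
Proof. rewrite !Cmod2_alt; unfold dot, cross; ring. Qed.

Lemma Csub_neq0 (x y : C) : x <> y -> x - y <> 0.
Proof.
  intros H E; apply H; replace x with (x - y + y) by ring; rewrite E; ring.
Qed.

Lemma Cmod_neq0 (u : C) : u <> 0 -> Cmod u <> 0%R.
Proof. intros Hu H; apply Hu, Cmod_eq_0, H. Qed.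

(** * Derivative of the modulus along a curve *)

Lemma is_derive_Re (g : R -> C) (x : R) (v : C) :
  is_derive (K := R_AbsRing) (V := C_R_NormedModule) g x v ->
  is_derive (fun t => Re (g t)) x (Re v).
Proof.
  intros Hg.
  apply (filterdiff_comp (U := R_NormedModule) (V := C_R_NormedModule)
    (W := R_NormedModule) g (fun z : C => fst z) _ (fun z : C => fst z) Hg).
  apply filterdiff_linear, is_linear_fst.
Qed.

Lemma is_derive_Im (g : R -> C) (x : R) (v : C) :
  is_derive (K := R_AbsRing) (V := C_R_NormedModule) g x v ->
  is_derive (fun t => Im (g t)) x (Im v).
Proof.
  intros Hg.
  apply (filterdiff_comp (U := R_NormedModule) (V := C_R_NormedModule)
    (W := R_NormedModule) g (fun z : C => snd z) _ (fun z : C => snd z) Hg).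
  apply filterdiff_linear, is_linear_snd.
Qed.

Lemma is_derive_norm2 (f1 f2 : R -> R) (x l1 l2 : R) :
  is_derive f1 x l1 -> is_derive f2 x l2 -> (0 < f1 x ^ 2 + f2 x ^ 2)%R ->
  is_derive (fun t => sqrt (f1 t ^ 2 + f2 t ^ 2)) x
    ((l1 * f1 x + l2 * f2 x) / sqrt (f1 x ^ 2 + f2 x ^ 2))%R.
Proof.
  intros H1 H2 Hpos.
  auto_derive.
  - repeat split; try (eexists; eassumption). simpl in Hpos; lra.
  - change (fun x0 : R => f1 x0) with f1; change (fun x0 : R => f2 x0) with f2.
    rewrite (is_derive_unique f1 x l1 H1), (is_derive_unique f2 x l2 H2).
    replace (f1 x * (f1 x * 1) + f2 x * (f2 x * 1))%R
      with (f1 x ^ 2 + f2 x ^ 2)%R by ring.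
    field.
    apply Rgt_not_eq, sqrt_lt_R0, Hpos.
Qed.

Lemma is_derive_Cmod (g : R -> C) (x : R) (v : C) :
  is_derive (K := R_AbsRing) (V := C_R_NormedModule) g x v ->
  g x <> 0 ->
  is_derive (fun t => Cmod (g t)) x (dot v (g x) / Cmod (g x))%R.
Proof.
  intros Hg Hne.
  apply (is_derive_norm2 (fun t => Re (g t)) (fun t => Im (g t))).
  - apply is_derive_Re, Hg.
  - apply is_derive_Im, Hg.
  - rewrite <- Cmod2_alt; apply pow_lt, Cmod_gt_0, Hne.
Qed.

Lemma is_derive_Cminus_const (g : R -> C) (x : R) (v a : C) :
  is_derive (K := R_AbsRing) (V := C_R_NormedModule) g x v ->
  is_derive (K := R_AbsRing) (V := C_R_NormedModule) (fun t => g t - a) x v.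
Proof.
  intros Hg.
  replace v with (v - 0) by ring.
  apply (is_derive_minus (K := R_AbsRing) (V := C_R_NormedModule) g (fun _ => a));
    [exact Hg | apply (is_derive_const (K := R_AbsRing) (V := C_R_NormedModule))].
Qed.

Lemma is_derive_square (f : R -> R) (x l : R) :
  is_derive f x l -> is_derive (fun t => (f t ^ 2)%R) x (2 * l * f x)%R.
Proof.
  intros H.
  auto_derive; [eexists; exact H |].
  change (fun x0 : R => f x0) with f; rewrite (is_derive_unique f x l H); ring.
Qed.

(** * Focal distances of a tangent line *)

(** The sign [e] is [1] for an ellipse and [-1] for a hyperbola. *)
Lemma central_conic_equation (a1 a2 : C) (S : C -> Prop) :
  is_central_conic_with_foci a1 a2 S ->
  exists e r : R, (e * e = 1)%R /\ r <> 0%R /\ (r ^ 2 <> Cmod (a1 - a2) ^ 2)%R /\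
    forall z, S z -> ((Cmod (z - a1) + e * Cmod (z - a2)) ^ 2 = r ^ 2)%R.
Proof.
  assert (Hd := Cmod_ge_0 (a1 - a2)).
  intros [[r [Hr HS]] | [r [Hr HS]]].
  - exists 1%R, r; repeat split; try nra.
    intros z Hz; apply HS in Hz; rewrite <- Hz; ring.
  - exists (-1)%R, r; repeat split; try nra.
    intros z Hz; apply HS in Hz; rewrite <- Hz, pow2_abs; ring.
Qed.

(** The reflection property [x1 / s1 + e * x2 / s2 = 0] gives
    [y1 / s1 = e * y2 / s2] or [y1 / s1 = - e * y2 / s2]; the second case would
    make the focal distance equal to [r]. *)
Lemma reflection_focal_product (e r d s1 s2 x1 x2 y1 y2 V : R) :
  (e * e = 1 -> s1 <> 0 -> s2 <> 0 -> V <> 0 ->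
   x1 * s2 + e * x2 * s1 = 0 ->
   x1 ^ 2 + y1 ^ 2 = s1 ^ 2 * V -> x2 ^ 2 + y2 ^ 2 = s2 ^ 2 * V ->
   (s1 + e * s2) ^ 2 = r ^ 2 -> r ^ 2 <> d ^ 2 ->
   (x1 - x2) ^ 2 + (y1 - y2) ^ 2 = d ^ 2 * V ->
   4 * (y1 * y2) = (r ^ 2 - d ^ 2) * V)%R.
Proof.
  intros He H1 H2 HV Hx E1 E2 Hr Hrd Hd.
  (* In the application, [c] and [s] are the dot and cross products of [v] with the unit vector from
     the first focus to the point of tangency. *)
  set (c := (x1 / s1)%R); set (s := (y1 / s1)%R).
  assert (Ex1 : x1 = (s1 * c)%R) by (unfold c; field; assumption).
  assert (Ey1 : y1 = (s1 * s)%R) by (unfold s; field; assumption).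
  clearbody c s; subst x1 y1.
  assert (Ex2 : x2 = (- e * s2 * c)%R).
  { apply (Rmult_eq_reg_l s1); [|assumption].
    replace (s1 * x2)%R with (e * e * x2 * s1)%R by (rewrite He; ring).
    replace (e * e * x2 * s1)%R with
      (e * (s1 * c * s2 + e * x2 * s1) - e * s1 * c * s2)%R by ring.
    rewrite Hx; ring. }
  subst x2.
  assert (EV : V = (c ^ 2 + s ^ 2)%R).
  { apply (Rmult_eq_reg_l (s1 ^ 2)); [|apply pow_nonzero; assumption].
    rewrite <- E1; ring. }
  subst V.
  assert (Ee : (e ^ 2 = 1)%R) by (simpl; rewrite Rmult_1_r; exact He).
  assert (Hprod : ((y2 - e * s2 * s) * (y2 + e * s2 * s) = 0)%R).
  { replace ((y2 - e * s2 * s) * (y2 + e * s2 * s))%R with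
      ((- e * s2 * c) ^ 2 + y2 ^ 2 - e ^ 2 * s2 ^ 2 * (c ^ 2 + s ^ 2))%R by ring.
    rewrite E2, Ee; ring. }
  rewrite <- Hr.
  apply Rmult_integral in Hprod as [Hy | Hy].
  - assert (Ey : y2 = (e * s2 * s)%R) by lra; subst y2.
    rewrite Rmult_minus_distr_r, <- Hd; ring.
  - assert (Ey : y2 = (- e * s2 * s)%R) by lra; subst y2.
    exfalso; apply Hrd, (Rmult_eq_reg_r (c ^ 2 + s ^ 2)%R); [|assumption].
    rewrite <- Hd, <- Hr; ring.
Qed.

Lemma tangent_focal_product (a1 a2 : C) (S : C -> Prop) :
  is_central_conic_with_foci a1 a2 S ->
  exists k : R, forall p v : C, S p -> v <> 0 -> tangent_vector S p v ->
    (4 * (cross v (p - a1) * cross v (p - a2)) = k * Cmod v ^ 2)%R.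
Proof.
  intros HS; apply central_conic_equation in HS as [e [r [He [Hr [Hrd HS]]]]].
  (* With [b] the minor or conjugate semiaxis, this constant is [4 * b ^ 2] for an ellipse and
     [- 4 * b ^ 2] for a hyperbola. *)
  exists (r ^ 2 - Cmod (a1 - a2) ^ 2)%R; intros p v Hp Hv [g [Hg0 [HgS Hg]]].
  assert (HSp := HS p Hp).
  (* A focus on the conic would force [r ^ 2 = Cmod (a1 - a2) ^ 2]. Away from the foci both focal
     distances are differentiable. *)
  assert (Hp1 : p <> a1).
  { intros ->; apply Hrd; rewrite <- HSp.
    replace (a1 - a1) with (RtoC 0) by ring; rewrite Cmod_0.
    transitivity (e * e * Cmod (a1 - a2) ^ 2)%R; [ring | rewrite He; ring]. }
  assert (Hp2 : p <> a2).
  { intros ->; apply Hrd; rewrite <- HSp.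
    replace (a2 - a2) with (RtoC 0) by ring; rewrite Cmod_0.
    rewrite <- (Cmod_opp (a2 - a1)).
    replace (- (a2 - a1)) with (a1 - a2) by ring; ring. }
  apply Csub_neq0 in Hp1; apply Csub_neq0 in Hp2.
  assert (Hs1 := Cmod_neq0 _ Hp1); assert (Hs2 := Cmod_neq0 _ Hp2).
  apply reflection_focal_product with
    (e := e) (s1 := Cmod (p - a1)) (s2 := Cmod (p - a2))
    (x1 := dot v (p - a1)) (x2 := dot v (p - a2)); auto using pow_nonzero, Cmod_neq0.
  - assert (Hderiv : forall a, p - a <> 0 ->
      is_derive (fun t => Cmod (g t - a)) 0%R (dot v (p - a) / Cmod (p - a))%R).
    { intros a Ha; rewrite <- Hg0 in Ha |- *.
      apply is_derive_Cmod with (g := fun t => g t - a);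
        [apply is_derive_Cminus_const, Hg | exact Ha]. }
    assert (D1 := Hderiv a1 Hp1); assert (D2 := Hderiv a2 Hp2).
    set (h := fun t => (Cmod (g t - a1) + e * Cmod (g t - a2))%R).
    set (h' := (dot v (p - a1) / Cmod (p - a1)
                + e * (dot v (p - a2) / Cmod (p - a2)))%R).
    assert (Dh : is_derive h 0%R h').
    { apply (is_derive_plus (V := R_NormedModule)); [exact D1 |].
      apply is_derive_scal; exact D2. }
    (* Only the square of [h] is known to be constant along the curve, since on a hyperbola the sign
       of [h] depends on the branch. As [h 0] squares to [r ^ 2], which is nonzero, this still gives
       [h' = 0], the reflection property. *)
    assert (Dh2 : is_derive (fun t => (h t ^ 2)%R) 0%R (2 * h' * h 0)%R).
    { apply is_derive_square, Dh. }
    assert (Dc : is_derive (fun t => (h t ^ 2)%R) 0%R 0%R).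
    { apply (is_derive_ext_loc (fun _ => (r ^ 2)%R)).
      - apply (filter_imp (fun t => S (g t))); [|exact HgS].
        intros t Ht; symmetry; exact (HS _ Ht).
      - apply (is_derive_const (V := R_NormedModule)). }
    assert (E : (2 * h' * h 0 = 0)%R).
    { rewrite <- (is_derive_unique _ _ _ Dh2); apply is_derive_unique, Dc. }
    assert (Hh0 : h 0%R <> 0%R).
    { intros H; apply Hr; unfold h in H; rewrite Hg0 in H; rewrite H in HSp.
      simpl in HSp; nra. }
    apply Rmult_integral in E as [E | E]; [|contradiction].
    assert (E' : h' = 0%R) by lra.
    transitivity (h' * Cmod (p - a1) * Cmod (p - a2))%R.
    + unfold h'; field; split; assumption.
    + rewrite E'; ring.
  - apply dot_cross_square.
  - apply dot_cross_square.
  - rewrite !Cmod2_alt; unfold dot, cross; simpl; ring.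
Qed.

(** * Tangent chords of the unit circle *)

Lemma Cconj_unit (z : C) : on_unit_circle z -> z * Cconj z = 1.
Proof. intros H; rewrite <- Cmod2_conj, H; simpl; f_equal; ring. Qed.

(** [cross u w] is the imaginary part of [Cconj u * w], so each factor on the right is [2 * Ci]
    times a cross product. *)
Lemma cross_product_conj (u w1 w2 : C) :
  RtoC (4 * (cross u w1 * cross u w2))
  = - (Cconj u * w1 - u * Cconj w1) * (Cconj u * w2 - u * Cconj w2).
Proof. apply injective_projections; unfold cross, Re, Im; simpl; ring. Qed.

(** For [z], [w] on the unit circle, [a + z * w * Cconj a - (z + w)] vanishes
    exactly when [a] lies on the chord, and it is twice the signed distance of
    [a] from it up to a square root of [z * w]. *)
Lemma chord_focal_product (z w p v a1 a2 : C) (k s t : R) :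
  on_unit_circle z -> on_unit_circle w -> z <> w ->
  z = p + s * v -> w = p + t * v ->
  (4 * (cross v (p - a1) * cross v (p - a2)) = k * Cmod v ^ 2)%R ->
  (a1 + z * w * Cconj a1 - (z + w)) * (a2 + z * w * Cconj a2 - (z + w))
  = k * (z * w).
Proof.
  intros Hz Hw Hzw Ez Ew Hk.
  apply Cconj_unit in Hz; apply Cconj_unit in Hw.
  (* The focal product relation is homogeneous of degree 2 in the direction and unaffected by moving
     the base point along the line, so [v] and [p] may be replaced by [z - w] and [z]. *)
  assert (Hcross : forall a, cross (z - w) (z - a) = ((s - t) * cross v (p - a))%R).
  { intros a; rewrite Ez, Ew; unfold cross, Re, Im; simpl; ring. }
  assert (Hmod : (Cmod (z - w) ^ 2 = (s - t) ^ 2 * Cmod v ^ 2)%R).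
  { rewrite !Cmod2_alt, Ez, Ew; unfold Re, Im; simpl; ring. }
  assert (Hk' : (4 * (cross (z - w) (z - a1) * cross (z - w) (z - a2))
                 = k * Cmod (z - w) ^ 2)%R).
  { rewrite !Hcross, Hmod.
    transitivity ((s - t) ^ 2 * (4 * (cross v (p - a1) * cross v (p - a2))))%R;
      [ring | rewrite Hk; ring]. }
  clear Hcross Hmod Hk Ez Ew.
  assert (Hz0 : z <> 0).
  { intros ->; apply C1_nz; rewrite <- Hz; ring. }
  assert (Hw0 : w <> 0).
  { intros ->; apply C1_nz; rewrite <- Hw; ring. }
  assert (Cz : Cconj z = / z).
  { transitivity (z * Cconj z * / z); [field | rewrite Hz; ring]; assumption. }
  assert (Cw : Cconj w = / w).
  { transitivity (w * Cconj w * / w); [field | rewrite Hw; ring]; assumption. }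
  apply Csub_neq0 in Hzw.
  assert (HX : forall a, Cconj (z - w) * (z - a) - (z - w) * Cconj (z - a)
    = (z - w) / (z * w) * (a + z * w * Cconj a - (z + w))).
  { intros a; rewrite !Cminus_conj, Cz, Cw; field; split; assumption. }
  apply (f_equal RtoC) in Hk'.
  rewrite cross_product_conj, !HX, RtoC_mult, Cmod2_conj, Cminus_conj, Cz, Cw
    in Hk'.
  set (A := a1 + _ - _) in *; set (B := a2 + _ - _) in *.
  transitivity (- ((z - w) / (z * w) * A) * ((z - w) / (z * w) * B)
    * (- (z * w) ^ 2 / (z - w) ^ 2)).
  - field; repeat split; assumption.
  - rewrite Hk'; field; repeat split; assumption.
Qed.

Lemma is_tangent_chord (z w : C) (S : C -> Prop) :
  is_tangent_line (line_through z w) S ->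
  exists (p v : C) (s t : R), S p /\ v <> 0 /\ tangent_vector S p v /\
    z = p + s * v /\ w = p + t * v.
Proof.
  intros [p [v [Hp [Hv [Ht HL]]]]].
  destruct (proj1 (HL z)) as [s Hs]; [exists 0%R; ring |].
  destruct (proj1 (HL w)) as [t Ht']; [exists 1%R; ring |].
  exists p, v, s, t; auto.
Qed.

(** * The quartic with the vertices as roots *)

Lemma quadratic_three_roots (A B D x y z : C) :
  x <> y -> y <> z -> z <> x ->
  A * x ^ 2 + B * x + D = 0 -> A * y ^ 2 + B * y + D = 0 ->
  A * z ^ 2 + B * z + D = 0 -> D = 0.
Proof.
  intros Hxy Hyz Hzx Hx Hy Hz.
  apply Csub_neq0 in Hxy; apply Csub_neq0 in Hyz; apply Csub_neq0 in Hzx.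
  (* Lagrange interpolation at 0 *)
  transitivity (y * z / ((x - y) * - (z - x)) * (A * x ^ 2 + B * x + D)
    + x * z / (- (x - y) * (y - z)) * (A * y ^ 2 + B * y + D)
    + x * y / (- (z - x) * (y - z)) * (A * z ^ 2 + B * z + D)).
  - field; repeat split; assumption.
  - rewrite Hx, Hy, Hz; ring.
Qed.

(** Multiplied by [z ^ 2], the equation of the chord opposite to [z] says that
    [z] is a root of the quartic
    [(w^2 - (e1 - a1) * w + l * b1) * (w^2 - (e1 - a2) * w + l * b2) - k * l * w]
    with [e1 = x + y + z] and [l = x * y * z]. Comparing its coefficients with
    those of [(w - x) * (w - y) * (w - z) * (w - c)] gives [l ^ 2 * b1 * b2 = l * c]
    and [e1 = a1 + a2 + c]. *)
Lemma chord_equations_sum (x y z a1 a2 b1 b2 k : C) :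
  x <> y -> y <> z -> z <> x -> x * y * z <> 0 ->
  (a1 + x * y * b1 - (x + y)) * (a2 + x * y * b2 - (x + y)) = k * (x * y) ->
  (a1 + y * z * b1 - (y + z)) * (a2 + y * z * b2 - (y + z)) = k * (y * z) ->
  (a1 + z * x * b1 - (z + x)) * (a2 + z * x * b2 - (z + x)) = k * (z * x) ->
  x + y + z = a1 + a2 + b1 * b2 * (x * y * z).
Proof.
  intros Hxy Hyz Hzx Hl Exy Eyz Ezx.
  set (e1 := x + y + z).
  set (e2 := x * y + y * z + z * x).
  set (l := x * y * z).
  (* The fourth root: the cubic coefficient of [f] makes the roots add up to [2 * e1 - a1 - a2]. *)
  set (c := e1 - a1 - a2).
  set (f := fun w => (w ^ 2 - (e1 - a1) * w + l * b1)
                     * (w ^ 2 - (e1 - a2) * w + l * b2) - k * l * w).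
  assert (Fx : f x = 0).
  { transitivity (x ^ 2 * ((a1 + y * z * b1 - (y + z)) * (a2 + y * z * b2 - (y + z))
      - k * (y * z))); [unfold f, e1, l; ring | rewrite Eyz; ring]. }
  assert (Fy : f y = 0).
  { transitivity (y ^ 2 * ((a1 + z * x * b1 - (z + x)) * (a2 + z * x * b2 - (z + x))
      - k * (z * x))); [unfold f, e1, l; ring | rewrite Ezx; ring]. }
  assert (Fz : f z = 0).
  { transitivity (z ^ 2 * ((a1 + x * y * b1 - (x + y)) * (a2 + x * y * b2 - (x + y))
      - k * (x * y))); [unfold f, e1, l; ring | rewrite Exy; ring]. }
  (* By the choice of [c], subtracting [(w - x) * (w - y) * (w - z) * (w - c)] from [f w] cancels
     the cubic terms too. The quadratic that is left vanishes at [x], [y], [z], hence so does its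
     constant coefficient [D]. *)
  set (A := (e1 - a1) * (e1 - a2) + l * (b1 + b2) - (e2 + c * e1)).
  set (B := l + c * e2 - k * l - l * (b2 * (e1 - a1) + b1 * (e1 - a2))).
  set (D := l ^ 2 * b1 * b2 - l * c).
  assert (Hf : forall w, A * w ^ 2 + B * w + D
    = f w - (w - x) * (w - y) * (w - z) * (w - c)).
  { intros w; unfold A, B, D, f, c, e2, l, e1; ring. }
  assert (HD : D = 0).
  { apply (quadratic_three_roots A B D x y z); auto;
      rewrite Hf, ?Fx, ?Fy, ?Fz; ring. }
  assert (Hc : c = b1 * b2 * l).
  { transitivity ((l ^ 2 * b1 * b2 - D) / l); [unfold D | rewrite HD]; field; exact Hl. }
  rewrite <- Hc; unfold c; ring.
Qed.

Theorem theorem3p3 (z1 z2 z3 a1 a2 : C) (conic : C -> Prop)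
  (hz1 : on_unit_circle z1) (hz2 : on_unit_circle z2) (hz3 : on_unit_circle z3)
  (htriangle : is_triangle z1 z2 z3)
  (hconic : is_central_conic_with_foci a1 a2 conic)
  (hcirc : circumscribed_about z1 z2 z3 conic) :
  exists lambda : C,
    on_unit_circle lambda /\
    z1 + z2 + z3 = a1 + a2 + Cconj a1 * Cconj a2 * lambda /\
    z1 * z2 + z2 * z3 + z3 * z1 = a1 * a2 + (Cconj a1 + Cconj a2) * lambda /\
    z1 * z2 * z3 = lambda.
Proof.
  destruct htriangle as [h12 hline].
  assert (h23 : z2 <> z3).
  { intros <-; apply hline; exists 1%R; ring. }
  assert (h31 : z3 <> z1).
  { intros ->; apply hline; exists 0%R; ring. }
  destruct (tangent_focal_product _ _ _ hconic) as [k hk].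
  assert (hchord : forall z w, on_unit_circle z -> on_unit_circle w -> z <> w ->
    is_tangent_line (line_through z w) conic ->
    (a1 + z * w * Cconj a1 - (z + w)) * (a2 + z * w * Cconj a2 - (z + w))
    = k * (z * w)).
  { intros z w hz hw hzw hL.
    destruct (is_tangent_chord _ _ _ hL) as (p & v & s & t & Hp & Hv & Ht & Ez & Ew).
    exact (chord_focal_product z w p v a1 a2 k s t hz hw hzw Ez Ew (hk p v Hp Hv Ht)). }
  destruct hcirc as [L12 [L23 L31]].
  assert (hl : on_unit_circle (z1 * z2 * z3)).
  { unfold on_unit_circle in *; rewrite !Cmod_mult, hz1, hz2, hz3; ring. }
  assert (hl0 : z1 * z2 * z3 <> 0).
  { intros H; unfold on_unit_circle in hl; rewrite H, Cmod_0 in hl; lra. }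
  assert (hsum : z1 + z2 + z3 = a1 + a2 + Cconj a1 * Cconj a2 * (z1 * z2 * z3)).
  { apply chord_equations_sum with (k := RtoC k); auto. }
  exists (z1 * z2 * z3); repeat split; [exact hl | exact hsum |].
  (* The second identity is [z1 * z2 * z3] times the conjugate of the first. *)
  apply Cconj_unit in hl.
  apply Cconj_unit in hz1; apply Cconj_unit in hz2; apply Cconj_unit in hz3.
  apply (f_equal Cconj) in hsum.
  rewrite !Cplus_conj, (Cmult_conj (Cconj a1 * Cconj a2)), Cmult_conj, !Cconj_conj
    in hsum.
  transitivity (z1 * z2 * z3 * (Cconj z1 + Cconj z2 + Cconj z3)).
  - transitivity (z1 * z2 * (z3 * Cconj z3) + z2 * z3 * (z1 * Cconj z1)
      + z3 * z1 * (z2 * Cconj z2)); [rewrite hz1, hz2, hz3 |]; ring.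
  - rewrite hsum.
    transitivity (a1 * a2 * (z1 * z2 * z3 * Cconj (z1 * z2 * z3))
      + (Cconj a1 + Cconj a2) * (z1 * z2 * z3)); [| rewrite hl]; ring.
Qed.
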